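(* Let $(S,\mathfrak m_S,k)$ and $(T,\mathfrak m_T,k)$ be Noetherian local rings with the same residue field $k$. Then $$\max\{\operatorname{cs}(S),\operatorname{cs}(T)\}\le\operatorname{cs}(S\times_kT)\le\operatorname{cs}(S)+\operatorname{cs}(T)\quad\text{and}\quad \operatorname{ms}(S\times_kT)=\max\{\operatorname{ms}(S),\operatorname{ms}(T)\}.$$
   Context: Rings are commutative with unity. For a Noetherian local ring $(R,\mathfrak m)$ with residue field $k$, $\mu(I)=\dim_k(I/\mathfrak mI)$ is the minimal number of generators of an ideal $I$, and $$\operatorname{cs}(R)=\min\{\mu(I): I\subseteq\mathfrak m \text{ an ideal with } I^2=\mathfrak m^2\},\qquad \operatorname{ms}(R)=\min\{\mu(I): I\subseteq \mathfrak m \text{ an ideal with } I\supseteq \mathfrak m^2\}.$$ With canonical surjections $\pi_S:S\to k$ and $\pi_T:T\to k$, the fiber product is the subring $S\times_kT=\{(a,b)\in S\times T:\pi_S(a)=\pi_T(b)\}$ of $S\times T$; it is a Noetherian local ring with maximal ideal $\mathfrak m_S\oplus\mathfrak m_T$. *)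

(* Defs.v *)
From HB Require Import structures.
From mathcomp Require Import all_boot all_order all_algebra.
From mathcomp Require Import ring_quotient generic_quotient.
From mathcomp Require Import boolp classical_sets.

Set Implicit Arguments.
Unset Strict Implicit.
Unset Printing Implicit Defensive.

Import GRing.Theory.
Local Open Scope quotient_scope.
Local Open Scope classical_set_scope.
Local Open Scope ring_scope.

(* Ideals of R are the submodules of the regular module R^o. Since membership
   predicates are boolean, undecidable ones are obtained with `[< _ >]. *)
Notation ideal R := (submodClosed R^o).

Section Ideals.
Variable R : comNzRingType.
Implicit Types I J : ideal R.

Lemma idealM I (a x : R) : x \in I -> a * x \in I.
Proof. exact: (@rpredZ _ _ I a x). Qed.

Lemma big_split_mul n p (a b : 'I_n -> R) (a' b' : 'I_p -> R) :
  \sum_(i < n + p) match split i with inl i => a i | inr i => a' i end *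
                   match split i with inl i => b i | inr i => b' i end =
  \sum_i a i * b i + \sum_i a' i * b' i.
Proof.
rewrite big_split_ord /=; congr (_ + _); apply: eq_bigr => i _.
  by rewrite (unsplitK (inl i)).
by rewrite (unsplitK (inr i)).
Qed.

(* The product ideal: finite sums of products. *)
Definition mulI I J : {pred R^o} := fun x =>
  `[< exists n (a b : 'I_n -> R),
      [/\ forall i, a i \in I, forall i, b i \in J & x = \sum_i a i * b i] >].

Lemma mulIP I J (x : R) : reflect (exists n (a b : 'I_n -> R),
  [/\ forall i, a i \in I, forall i, b i \in J & x = \sum_i a i * b i])
  (x \in mulI I J).
Proof. exact: asboolP. Qed.

Lemma mulI_submod_closed I J : submod_closed (mulI I J).
Proof.
split.
  apply/mulIP; exists 0%N, (fun=> 0), (fun=> 0).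
  by split=> [[]//|[]//|]; rewrite big_ord0.
move=> c x y /mulIP[n [a [b [aI bJ ->]]]] /mulIP[m [a' [b' [aI' bJ' ->]]]].
apply/mulIP; exists (n + m)%N.
exists (fun i => match split i with inl i => c * a i | inr i => a' i end).
exists (fun i => match split i with inl i => b i | inr i => b' i end).
split=> [i|i|]; try by case: (split i) => j; rewrite ?idealM.
rewrite (big_split_mul (fun i => c * a i)) [c *: _]mulr_sumr.
by congr (_ + _); apply: eq_bigr => i _; rewrite mulrA.
Qed.

HB.instance Definition _ I J :=
  GRing.isSubmodClosed.Build R R^o (mulI I J) (mulI_submod_closed I J).

Definition noetherian : Prop := forall I, exists n (a : 'I_n -> R),
  forall x : R, x \in I <-> exists c : 'I_n -> R, x = \sum_i c i * a i.

Definition maximal_ideal I : Prop :=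
  (1 : R^o) \notin I /\
  forall J, {subset I <= J} -> J =i I \/ (forall x, x \in J).

Definition unique_maximal_ideal I : Prop :=
  maximal_ideal I /\ forall J, maximal_ideal J -> J =i I.

End Ideals.

Section Kernel.
Variables (R : comNzRingType) (k : fieldType) (f : {rmorphism R -> k}).

Definition kerI : {pred R^o} := fun x => f x == 0.

Lemma kerIE (x : R) : (x \in kerI) = (f x == 0). Proof. by []. Qed.

Lemma kerI_submod_closed : submod_closed kerI.
Proof.
split=> [|a x y]; rewrite ?kerIE ?rmorph0 // => /eqP fx /eqP fy.
by rewrite rmorphD rmorphM /= fx fy mulr0 addr0.
Qed.

HB.instance Definition _ :=
  GRing.isSubmodClosed.Build R R^o kerI kerI_submod_closed.

End Kernel.

(* A Noetherian local ring (R, m, k): the residue field is given through the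
   canonical surjection onto k, whose kernel is the maximal ideal m. *)
Record nlring (k : fieldType) := NLRing {
  nlring_sort :> comNzRingType;
  residue : {rmorphism nlring_sort -> k};
  residue_surj : forall a, exists x, residue x = a;
  nlring_noetherian : noetherian nlring_sort;
  nlring_local : unique_maximal_ideal (kerI residue : ideal nlring_sort)
}.

Arguments residue {k} _.
Arguments residue_surj {k} _ _.

Definition maxideal (k : fieldType) (R : nlring k) : ideal R :=
  kerI (residue R).

Section Local_units.
Variables (k : fieldType) (R : nlring k).

Definition ideal_of (S : {pred R^o}) (S_ideal : submod_closed S) : ideal R :=
  HB.pack S (GRing.isSubmodClosed.Build R R^o S S_ideal).

Lemma nlring_unit (x : R) : residue R x != 0 -> exists y, x * y = 1.
Proof.
move=> x0; apply: contrapT => xNunit.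
pose P (A : set R) := A = set0 \/
  exists I : ideal R, [/\ A = [set` I], x \in I & (1 : R^o) \notin I].
have [F FP Ftot|A [PA Amax]] := @Zorn_bigcup R P.
  have [[X [z [FX Xz]]]|F0] := pselect (exists X z, F X /\ X z); last first.
    left; apply/seteqP; split=> // z [X FX Xz].
    by apply: F0; exists X, z.
  right; pose S : {pred R^o} := fun z => `[< (\bigcup_(X in F) X) z >].
  have S_closed : submod_closed S.
    split=> [|c u v /asboolP[U FU Uu] /asboolP[V FV Vv]]; apply/asboolP.
      exists X => //; have [X0|[I [XI _ _]]] := FP _ FX.
        by rewrite X0 in Xz.
      by rewrite XI /=; exact: rpred0.
    have [W FW [Wu Wv]] : exists2 W, F W & W u /\ W v.
      by have [UV|VU] := Ftot _ _ FU FV;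
        [exists V|exists U] => //; split=> //; [exact: UV|exact: VU].
    exists W => //; have [W0|[I [WI _ _]]] := FP _ FW.
      by rewrite W0 in Wu.
    move: Wu Wv; rewrite WI /= => uI vI.
    by rewrite rpredD ?rpredZ.
  exists (ideal_of S_closed); split.
  - by apply/seteqP; split=> y /= => [yS|/asboolP//]; exact/asboolP.
  - apply/asboolP; exists X => //; have [X0|[I [XI xI _]]] := FP _ FX.
      by rewrite X0 in Xz.
    by rewrite XI.
  - apply/negP => /asboolP[Y FY Y1]; have [Y0|[I [YI _ /negP]]] := FP _ FY.
      by rewrite Y0 in Y1.
    by apply; rewrite YI in Y1.
pose px : {pred R^o} := fun z => `[< exists y, z = y * x >].
have px_closed : submod_closed px.
  split=> [|c u v /asboolP[y ->] /asboolP[z ->]]; apply/asboolP.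
    by exists 0; rewrite mul0r.
  by exists (c * y + z); rewrite mulrDl -mulrA.
have Pmax (J : ideal R) : x \in J -> (1 : R^o) \notin J ->
    (A `<=` [set` J]) -> A = [set` J].
  move=> xJ J1 AJ; apply: contrapT => AneJ; apply: (Amax [set` J]).
    by split=> // JA; apply: AneJ; exact/seteqP.
  by right; exists J.
have [A0|[I [AI xI I1]]] := PA.
  have xpx : x \in (ideal_of px_closed) by apply/asboolP; exists 1; rewrite mul1r.
  have px1 : (1 : R^o) \notin ideal_of px_closed.
    apply/negP => /asboolP[y yx]; apply: xNunit.
    by exists y; rewrite mulrC -yx.
  have /seteqP[_ /(_ x xpx)] : A = [set` ideal_of px_closed].
    by apply: Pmax => //; rewrite A0.
  by rewrite A0.
have Imax : maximal_ideal I.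
  split=> // J IJ; have [J1|J1] := boolP ((1 : R^o) \in J).
    by right=> z; rewrite -[z]mulr1 idealM.
  have /seteqP[_ JA] : A = [set` J].
    by apply: Pmax => //; [exact: IJ|rewrite AI => z; exact: IJ].
  by left=> z; apply/idP/idP => [/JA|/IJ//]; rewrite AI.
have [_ /(_ I Imax x)] := nlring_local R.
by rewrite xI kerIE (negPf x0).
Qed.

End Local_units.

Section Ideal_as_module.
Variables (R : comNzRingType) (I : ideal R).

Record idmod := IdMod { idval : R^o; _ : idval \in I }.

HB.instance Definition _ := [isSub for idval].
HB.instance Definition _ := [Choice of idmod by <:].
HB.instance Definition _ := [SubChoice_isSubLmodule of idmod by <:].

End Ideal_as_module.

Section Quotient_by_mI.
Variables (k : fieldType) (R : nlring k) (I : ideal R).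
Local Notation m := (maxideal R).

Definition mI_in_I : {pred idmod I} := fun u => val u \in mulI m I.

Lemma mI_in_I_submod_closed : submod_closed mI_in_I.
Proof.
split=> [|a u v]; rewrite /in_mem /= /mI_in_I ?raddf0 ?rpred0 //.
by rewrite linearP => uI vI; rewrite rpredD ?rpredZ.
Qed.

HB.instance Definition _ :=
  GRing.isSubmodClosed.Build R (idmod I) mI_in_I mI_in_I_submod_closed.

(* I / mI, a k-vector space since m annihilates it. *)
Definition quotmI := {ideal_quot mI_in_I}.
HB.instance Definition _ := GRing.Zmodule.on quotmI.

Definition cls (u : idmod I) : quotmI := \pi_({ideal_quot mI_in_I}) u.

Lemma cls_zmod_morphism : zmod_morphism cls.
Proof. exact: raddfB. Qed.

HB.instance Definition _ :=
  GRing.isZmodMorphism.Build (idmod I) quotmI cls cls_zmod_morphism.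

Lemma cls_repr q : cls (repr q) = q. Proof. exact: reprK. Qed.

Lemma eq_cls u v : (cls u = cls v) <-> (val u - val v \in mulI m I).
Proof.
rewrite -raddfB /cls; split=> [/eqP|uv]; first by rewrite -Quotient.idealrBE.
by apply/eqP; rewrite -Quotient.idealrBE.
Qed.

Definition residue_lift (a : k) : R := sval (cid (residue_surj R a)).

Lemma residue_liftK a : residue R (residue_lift a) = a.
Proof. exact: (svalP (cid (residue_surj R a))). Qed.

Lemma mem_mI (a x : R) : residue R a = 0 -> x \in I -> a * x \in mulI m I.
Proof.
move=> a0 xI; apply/mulIP; exists 1%N, (fun=> a), (fun=> x).
by split=> [_|//|]; rewrite ?big_ord1 // kerIE a0.
Qed.

(* A scalar acts through any of its preimages in R, see quotmI_scaleE. *)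
Definition quotmI_scale (a : k) (q : quotmI) : quotmI :=
  cls (residue_lift a *: repr q).

Fact quotmI_scale_cls a (x : R) (u : idmod I) :
  residue R x = a -> quotmI_scale a (cls u) = cls (x *: u).
Proof.
move=> xa; apply/eq_cls; set y := residue_lift _; set v := repr _.
have /eq_cls vu : cls v = cls u by exact: cls_repr.
have -> : val (y *: v) - val (x *: u) =
          y *: (val v - val u) + (y - x) *: val u.
  by rewrite !linearZ /= scalerBr scalerBl scalerN addrA subrK.
apply: rpredD; first exact: rpredZ.
apply: mem_mI; last exact: valP u.
by rewrite rmorphB /= residue_liftK xa subrr.
Qed.

Fact quotmI_scaleA a b q :
  quotmI_scale a (quotmI_scale b q) = quotmI_scale (a * b) q.
Proof.
rewrite -[q]cls_repr (quotmI_scale_cls _ (residue_liftK b)).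
rewrite (quotmI_scale_cls _ (residue_liftK a)) scalerA; apply/esym.
by apply: quotmI_scale_cls; rewrite rmorphM /= !residue_liftK.
Qed.

Fact quotmI_scale1 : left_id 1 quotmI_scale.
Proof.
move=> q; rewrite -[q in LHS]cls_repr.
by rewrite (quotmI_scale_cls _ (rmorph1 _)) scale1r cls_repr.
Qed.

Fact quotmI_scaleDr : right_distributive quotmI_scale +%R.
Proof.
move=> a q r; rewrite -[q]cls_repr -[r]cls_repr -raddfD.
by rewrite !(quotmI_scale_cls _ (residue_liftK a)) scalerDr raddfD.
Qed.

Fact quotmI_scaleDl q : {morph quotmI_scale^~ q : a b / a + b}.
Proof.
move=> a b /=; rewrite -[q]cls_repr.
rewrite (quotmI_scale_cls _ (residue_liftK a)) (quotmI_scale_cls _ (residue_liftK b)).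
rewrite -raddfD -scalerDl.
by apply: quotmI_scale_cls; rewrite rmorphD /= !residue_liftK.
Qed.

HB.instance Definition _ := GRing.Zmodule_isLmodule.Build k quotmI
  quotmI_scaleA quotmI_scale1 quotmI_scaleDr quotmI_scaleDl.

Lemma quotmI_scaleE (x : R) (u : idmod I) :
  residue R x *: cls u = cls (x *: u).
Proof. exact: quotmI_scale_cls. Qed.

End Quotient_by_mI.

(* The minimum of a set of naturals, 0 if the set is empty; the sets below
   contain mu m. *)
Definition minnat (A : set nat) : nat :=
  xget 0%N [set n | A n /\ forall p, A p -> (n <= p)%N].

Definition has_dim (k : fieldType) (V : lmodType k) (n : nat) : Prop :=
  exists f : {linear V -> 'rV[k]_n}, bijective f.

(* The dimension of a k-vector space, 0 if it is infinite; the I / mI below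
   are finite-dimensional since R is Noetherian. *)
Definition dimension (k : fieldType) (V : lmodType k) : nat :=
  xget 0%N [set n | has_dim V n].

Section Invariants.
Variables (k : fieldType) (R : nlring k).
Local Notation m := (maxideal R).

Definition mu (I : ideal R) : nat := dimension (quotmI I).

Definition cs : nat := minnat
  [set mu I | I in [set I : ideal R |
    {subset I <= m} /\ mulI I I =i mulI m m]].

Definition ms : nat := minnat
  [set mu I | I in [set I : ideal R |
    {subset I <= m} /\ {subset mulI m m <= I}]].

End Invariants.

Section Fiber_product.
Variables (k : fieldType) (S T : nlring k).

Definition fiber_pred : {pred (S * T)%type} :=
  fun x => residue S x.1 == residue T x.2.

Lemma fiber_predE x : (x \in fiber_pred) = (residue S x.1 == residue T x.2).
Proof. by []. Qed.

Lemma fiber_subring_closed : subring_closed fiber_pred.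
Proof.
split=> [|x y|x y]; rewrite !fiber_predE ?rmorph1 //= => /eqP ex /eqP ey.
  by rewrite !rmorphB /= ex ey.
by rewrite !rmorphM /= ex ey.
Qed.

HB.instance Definition _ :=
  GRing.isSubringClosed.Build (S * T)%type fiber_pred fiber_subring_closed.

Record fiber := Fiber { fiberval : S * T; _ : fiberval \in fiber_pred }.

HB.instance Definition _ := [isSub for fiberval].
HB.instance Definition _ := [Choice of fiber by <:].
HB.instance Definition _ := [SubChoice_isSubComNzRing of fiber by <:].

Definition fiber_residue (x : fiber) : k := residue S (val x).1.

Fact fiber_residue_zmod_morphism : zmod_morphism fiber_residue.
Proof. by move=> x y; rewrite /fiber_residue !raddfB. Qed.

Fact fiber_residue_monoid_morphism : monoid_morphism fiber_residue.
Proof.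
by split=> [|x y]; rewrite /fiber_residue ?rmorph1 // !rmorphM.
Qed.

HB.instance Definition _ :=
  GRing.isZmodMorphism.Build fiber k fiber_residue fiber_residue_zmod_morphism.
HB.instance Definition _ := GRing.isMonoidMorphism.Build fiber k fiber_residue
  fiber_residue_monoid_morphism.

Lemma fiber_residue_surj a : exists x, fiber_residue x = a.
Proof.
have [[x xa] [y ya]] := (residue_surj S a, residue_surj T a).
have xy : (x, y) \in fiber_pred by rewrite fiber_predE /= xa ya.
by exists (Fiber xy).
Qed.

Lemma fiber_unit (x : fiber) : fiber_residue x != 0 -> exists y, x * y = 1.
Proof.
move=> x0; have [s xs] := nlring_unit x0.
have x0' : residue T (val x).2 != 0.
  by rewrite -(eqP (valP x : residue S _ == _)).
have [t xt] := nlring_unit x0'.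
have st : (s, t) \in fiber_pred.
  rewrite fiber_predE /=; apply/eqP/(mulfI x0).
  rewrite /fiber_residue -rmorphM xs rmorph1.
  by rewrite (eqP (valP x : residue S _ == _)) -rmorphM xt rmorph1.
exists (Fiber st); apply/val_inj => /=.
by rewrite [LHS](_ : _ = ((val x).1 * s, (val x).2 * t)) // xs xt.
Qed.

Lemma fiber_local : unique_maximal_ideal (kerI fiber_residue : ideal fiber).
Proof.
have ker1 : (1 : fiber) \notin kerI fiber_residue.
  by rewrite kerIE rmorph1 oner_neq0.
have sub_ker (J : ideal fiber) : (1 : fiber) \notin J ->
    {subset J <= kerI fiber_residue}.
  move=> J1 x xJ; rewrite kerIE; apply: contraNT J1 => /fiber_unit[y <-].
  by rewrite mulrC idealM.
split=> [|J [J1 Jmax]].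
  split=> // J kerJ; have [J1|J1] := boolP ((1 : fiber) \in J).
    by right=> x; rewrite -[x]mulr1 idealM.
  by left=> x; apply/idP/idP => [|/kerJ//]; exact: sub_ker.
have [E x|/(_ 1)] := Jmax _ (sub_ker J J1); first by rewrite E.
by rewrite (negPf ker1).
Qed.

Lemma fiber_fst (s : S) : exists x : fiber, (val x).1 = s.
Proof.
have [t ts] := residue_surj T (residue S s).
have st : (s, t) \in fiber_pred by rewrite fiber_predE /= ts.
by exists (Fiber st).
Qed.

Lemma fiber_snd (t : T) : exists x : fiber, (val x).2 = t.
Proof.
have [s st] := residue_surj S (residue T t).
have stP : (s, t) \in fiber_pred by rewrite fiber_predE /= st.
by exists (Fiber stP).
Qed.

(* I is generated by lifts of generators of its image in S, together with
   generators of {t | (0, t) \in I}. *)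
Lemma fiber_noetherian : noetherian fiber.
Proof.
move=> I.
pose IS : {pred S^o} :=
  fun s => `[< exists2 x : fiber, x \in I & (val x).1 = s >].
pose IT : {pred T^o} :=
  fun t => `[< exists x : fiber, [/\ x \in I, (val x).1 = 0 & (val x).2 = t] >].
have memI (d x y : fiber) : x \in I -> y \in I -> d * x + y \in I.
  by move=> xI yI; apply: rpredD => //; exact: idealM.
have IS_closed : submod_closed IS.
  split=> [|c u v /asboolP[x xI <-] /asboolP[y yI <-]]; apply/asboolP.
    by exists 0; [exact: rpred0|].
  by have [d <-] := fiber_fst c; exists (d * x + y); rewrite ?memI.
have IT_closed : submod_closed IT.
  split=> [|c u v /asboolP[x [xI x1 <-]] /asboolP[y [yI y1 <-]]]; apply/asboolP.
    by exists 0; split=> //; exact: rpred0.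
  have [d <-] := fiber_snd c; exists (d * x + y).
  split=> //; first exact: memI.
  by rewrite [LHS](_ : _ = (val d).1 * (val x).1 + (val y).1) // x1 y1 mulr0 addr0.
have [n [a aP]] := nlring_noetherian (ideal_of IS_closed).
have [p [b bP]] := nlring_noetherian (ideal_of IT_closed).
have /choice[x xP] i : exists x : fiber, x \in I /\ (val x).1 = a i.
  suff /asboolP[x xI xa] : a i \in ideal_of IS_closed by exists x.
  apply/aP; exists (fun j => (j == i)%:R).
  by rewrite (bigD1 i) //= eqxx mul1r big1 ?addr0 // => j /negPf->; rewrite mul0r.
have /choice[y yP] i : exists y : fiber,
    [/\ y \in I, (val y).1 = 0 & (val y).2 = b i].
  suff /asboolP[y yI] : b i \in ideal_of IT_closed by exists y.
  apply/bP; exists (fun j => (j == i)%:R).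
  by rewrite (bigD1 i) //= eqxx mul1r big1 ?addr0 // => j /negPf->; rewrite mul0r.
exists (n + p)%N, (fun i => match split i with inl i => x i | inr i => y i end).
move=> z; split=> [zI|[c ->]]; last first.
  apply: rpred_sum => i _; apply: idealM.
  by case: (split i) => j; [have [] := xP j|have [] := yP j].
have /aP[c cE] : (val z).1 \in ideal_of IS_closed by apply/asboolP; exists z.
have /choice[c' c'E] i := fiber_fst (c i).
pose w : fiber := z - \sum_i c' i * x i.
have fst_sum q (u : 'I_q -> fiber) : (val (\sum_i u i)).1 = \sum_i (val (u i)).1.
  by rewrite !raddf_sum.
have snd_sum q (u : 'I_q -> fiber) : (val (\sum_i u i)).2 = \sum_i (val (u i)).2.
  by rewrite !raddf_sum.
have w1 : (val w).1 = 0.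
  rewrite [LHS](_ : _ = (val z).1 - (val (\sum_i c' i * x i)).1) // fst_sum cE.
  apply/eqP; rewrite subr_eq0; apply/eqP/eq_bigr => i _.
  by rewrite -c'E -(xP i).2.
have /bP[d dE] : (val w).2 \in ideal_of IT_closed.
  apply/asboolP; exists w; split=> //; rewrite /w -mulN1r addrC.
  apply: memI => //; apply: rpred_sum => i _.
  by apply: idealM; case: (xP i).
have /choice[d' d'E] i := fiber_snd (d i).
exists (fun i => match split i with inl i => c' i | inr i => d' i end).
rewrite big_split_mul -[LHS](subrK (\sum_i c' i * x i)) addrC -/w.
have fiber_eq (u v : fiber) :
    (val u).1 = (val v).1 -> (val u).2 = (val v).2 -> u = v.
  move=> uv1 uv2; apply/val_inj.
  by rewrite [LHS]surjective_pairing uv1 uv2 -surjective_pairing.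
congr (_ + _); apply: fiber_eq.
  rewrite w1 fst_sum big1 // => i _; have [_ y1 _] := yP i.
  by rewrite [LHS](_ : _ = (val (d' i)).1 * (val (y i)).1) // y1 mulr0.
rewrite dE snd_sum; apply: eq_bigr => i _; have [_ _ <-] := yP i.
by rewrite -d'E.
Qed.

(* The maximal ideal of the fiber product, the kernel of fiber_residue, is
   m_S (+) m_T. *)
Definition fiber_product : nlring k :=
  NLRing fiber_residue_surj fiber_noetherian fiber_local.

End Fiber_product.

(* Main.v *)
(* By Nakayama, mu, cs and ms can be read off generating families. The images of
   an admissible ideal of the fiber product R in S and T are admissible, whence
   the lower bounds; for cs, the ideal I_S (+) I_T gives the upper bound. For
   ms, the family (a_i, b_i) built from generators of admissible ideals I_S and
   I_T generates an admissible ideal as soon as m_S^2 = m_S I_S and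
   m_T^2 = m_T I_T. This can be assumed: take I maximal among the ideals between
   m^2 and m generated by ms elements; if x y is in m^2 but not in m I, replacing
   one generator of I by x gives a strictly larger such ideal. *)

Require Import Defs.
From HB Require Import structures.
From mathcomp Require Import all_boot all_order all_algebra.
From mathcomp Require Import boolp classical_sets.

Set Implicit Arguments.
Unset Strict Implicit.
Unset Printing Implicit Defensive.

Import GRing.Theory.

(** * Products of ideals and finitely generated ideals *)

Section Spanned_ideals.
Local Open Scope ring_scope.
Variable R : comNzRingType.
Implicit Types I J K : ideal R.

Lemma mem_mulI I J (x y : R) : x \in I -> y \in J -> x * y \in mulI I J.
Proof.
move=> xI yJ; apply/mulIP; exists 1%N, (fun=> x), (fun=> y).
by split=> //; rewrite big_ord1.
Qed.

Lemma mulI_sub I J K : (forall x y : R, x \in I -> y \in J -> x * y \in K) ->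
  {subset mulI I J <= K}.
Proof.
move=> IJK z /mulIP[n [a [b [aI bJ ->]]]].
by apply: rpred_sum => i _; exact: IJK.
Qed.

Lemma mulI_mono I J I' J' : {subset I <= I'} -> {subset J <= J'} ->
  {subset mulI I J <= mulI I' J'}.
Proof. by move=> II' JJ'; apply: mulI_sub => x y /II' xI /JJ'; exact: mem_mulI. Qed.

Definition spanI n (a : 'I_n -> R) : {pred R^o} :=
  fun x => `[< exists c : 'I_n -> R, x = \sum_i c i * a i >].

Lemma spanIP n (a : 'I_n -> R) (x : R) :
  reflect (exists c : 'I_n -> R, x = \sum_i c i * a i) (x \in spanI a).
Proof. exact: asboolP. Qed.

Lemma spanI_submod_closed n (a : 'I_n -> R) : submod_closed (spanI a).
Proof.
split=> [|r x y /spanIP[c ->] /spanIP[d ->]]; apply/spanIP.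
  by exists (fun=> 0); rewrite big1 // => i _; rewrite mul0r.
exists (fun i => r * c i + d i); rewrite [r *: _]mulr_sumr -big_split /=.
by apply: eq_bigr => i _; rewrite mulrDl mulrA.
Qed.

HB.instance Definition _ n (a : 'I_n -> R) :=
  GRing.isSubmodClosed.Build R R^o (spanI a) (spanI_submod_closed a).

Lemma spanI_gen n (a : 'I_n -> R) i : a i \in spanI a.
Proof.
apply/spanIP; exists (fun j => (j == i)%:R).
by rewrite (bigD1 i) //= eqxx mul1r big1 ?addr0 // => j /negPf->; rewrite mul0r.
Qed.

Lemma spanI_sub n (a : 'I_n -> R) I :
  (forall i, a i \in I) -> {subset spanI a <= I}.
Proof.
by move=> aI x /spanIP[c ->]; apply: rpred_sum => i _; exact: idealM.
Qed.

(** Padding with zeros: [insub] recovers an index below [n] and [oapp] supplies 0 beyond it. A bound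
    on a number of generators thus becomes a family of exactly that length. *)
Lemma spanI_widen n p (a : 'I_n -> R) : (n <= p)%N ->
  exists b : 'I_p -> R, spanI a =i spanI b.
Proof.
move=> np; exists (fun i => oapp a 0 (insub (val i))) => x.
apply/idP/idP; apply: spanI_sub => i.
  rewrite -[a i](_ : oapp a 0 (insub (val (widen_ord np i))) = _).
    exact: (@spanI_gen _ (fun i : 'I_p => oapp a 0 (insub (val i)))).
  by rewrite /= valK.
by case: insubP => [j _ _|_] /=; [exact: spanI_gen | exact: rpred0].
Qed.

Lemma noetherianP : noetherian R <->
  forall I, exists n (a : 'I_n -> R), I =i spanI a.
Proof.
split=> RN I; have [n [a aI]] := RN I; exists n, a => x.
  by apply/idP/spanIP => /aI.
by rewrite aI; split=> /spanIP.
Qed.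

End Spanned_ideals.

(** * Dimension of finitely spanned vector spaces *)

Section Dimension.
Local Open Scope ring_scope.
Variables (k : fieldType) (V : lmodType k).

Definition spanning p (v : 'I_p -> V) :=
  forall x, exists c : 'I_p -> k, x = \sum_i c i *: v i.

(** The coordinates of the [v i] form a matrix with [p] rows whose row space is all of $k^d$, so its
    rank is $d$. *)
Lemma has_dim_le_spanning p (v : 'I_p -> V) d :
  spanning v -> has_dim V d -> (d <= p)%N.
Proof.
move=> vspan [f [g fK gK]]; pose A := \matrix_i f (v i).
suff /mxrankS : (1%:M <= A)%MS.
  by rewrite mxrank1 => /leq_trans; apply; exact: rank_leq_row.
apply/row_subP => i; have [c cE] := vspan (g (row i 1%:M)).
rewrite -[row i _]gK cE linear_sum summx_sub // => j _.
by rewrite linearZ scalemx_sub // -[f _](rowK (fun i => f (v i))) row_sub.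
Qed.

(** A spanning family of least length is a basis, so the [xget] in [dimension] does not fall back on
    its default 0. *)
Lemma has_dim_dimension p (v : 'I_p -> V) :
  spanning v -> has_dim V (dimension V).
Proof.
move=> vspan.
have exP : exists p, `[< exists v : 'I_p -> V, spanning v >].
  by exists p; apply/asboolP; exists v.
case: (ex_minnP exP) => n /asboolP[w wspan] nmin.
suff wn : has_dim V n by apply: (xgetI _ wn).
(* A relation with $c_i \neq 0$ would allow [w i] to be dropped, against the minimality of [n]. *)
have winj (c : 'I_n -> k) : \sum_i c i *: w i = 0 -> forall i, c i = 0.
  case: n w wspan nmin c => [|n] w wspan nmin c c0 i; first by case: i.
  apply/eqP/negPn/negP => ci0.
  have: (n.+1 <= n)%N; last by rewrite ltnn.
  apply: nmin; apply/asboolP; exists (fun j => w (lift i j)) => x.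
  have [d ->] := wspan x.
  (* These coefficients arise by substituting $w_i = -c_i^{-1} \sum_{j \neq i} c_j w_j$ into $\sum_j
     d_j w_j$. *)
  exists (fun j => d (lift i j) - d i / c i * c (lift i j)).
  move: c0; rewrite !(bigD1_ord i) //= => c0.
  have -> : w i = - (c i)^-1 *: \sum_j c (lift i j) *: w (lift i j).
    move/eqP: c0; rewrite addr_eq0 => /eqP c0.
    by rewrite scaleNr -scalerN -c0 scalerA mulVf ?scale1r.
  rewrite scalerA scaler_sumr -big_split /=; apply: eq_bigr => j _.
  by rewrite scalerA -scalerDl mulrN mulNr addrC.
have /choice[f fE] x : exists r : 'rV[k]_n, x = \sum_i r 0 i *: w i.
  have [c ->] := wspan x; exists (\row_i c i).
  by apply: eq_bigr => i _; rewrite mxE.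
(* Uniqueness of coordinates gives both the linearity of [f] and one of the two cancellation
   laws. *)
have f_uniq x (r : 'rV[k]_n) : x = \sum_i r 0 i *: w i -> f x = r.
  move=> xE; apply/rowP => i; apply/eqP; rewrite -subr_eq0; apply/eqP.
  apply: (winj (fun i => f x 0 i - r 0 i)).
  under eq_bigr do rewrite scalerBl.
  by rewrite sumrB -fE -xE subrr.
have f_lin : linear f.
  move=> a x y; apply: f_uniq; rewrite {1}(fE x) {1}(fE y) scaler_sumr -big_split.
  by apply: eq_bigr => i _; rewrite /= !mxE scalerDl scalerA.
pose fL := GRing.isLinear.Build k V 'rV[k]_n *:%R f f_lin.
exists (HB.pack_for {linear V -> 'rV[k]_n} f fL).
exists (fun r : 'rV[k]_n => \sum_i r 0 i *: w i) => [x|r] /=.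
  by rewrite -fE.
exact: f_uniq.
Qed.

End Dimension.

(** * Nakayama's lemma and minimal numbers of generators *)

Section Generators.
Local Open Scope ring_scope.
Local Open Scope classical_set_scope.
Variables (k : fieldType) (R : nlring k).
Local Notation m := (maxideal R).
Implicit Types I J : ideal R.

Lemma maxidealE (x : R) : (x \in m) = (residue R x == 0).
Proof. by []. Qed.

(** Expand the second factor of each product in the [g i] and collect: every coefficient is a sum of
    multiples of elements of $m$. *)
Lemma mem_mul_max_spanI n (g : 'I_n -> R) (x : R) : x \in mulI m (spanI g) ->
  exists2 c : 'I_n -> R, forall i, c i \in m & x = \sum_i c i * g i.
Proof.
move=> /mulIP[p [a [b [am bg ->]]]].
have /choice[c cE] j : exists c : 'I_n -> R, b j = \sum_i c i * g i.
  exact/spanIP.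
exists (fun i => \sum_j a j * c j i) => [i|].
  by apply: rpred_sum => j _; rewrite mulrC; exact: idealM.
under [RHS]eq_bigr do rewrite mulr_suml.
rewrite exchange_big; apply: eq_bigr => j _; rewrite cE mulr_sumr.
by apply: eq_bigr => i _; rewrite mulrA.
Qed.

(* The matrix [1 - C] is invertible, its determinant being 1 modulo [m]. *)
Lemma nakayama I n (g : 'I_n -> R) :
    (forall i, exists2 x : R, x \in mulI m (spanI g) & g i - x \in I) ->
  forall i, g i \in I.
Proof.
move=> gI.
have /choice[C CE] i : exists c : 'I_n -> R,
    (forall j, c j \in m) /\ g i - \sum_j c j * g j \in I.
  by have [x /mem_mul_max_spanI[c cm ->] xI] := gI i; exists c.
pose A : 'M[R]_n := 1%:M - \matrix_(i, j) C i j.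
pose G : 'cV[R]_n := \col_i g i.
have AG i : (A *m G) i 0 \in I.
  rewrite mulmxBl mul1mx !mxE.
  have [_] := CE i; congr (_ - _ \in I).
  by apply: eq_bigr => j _; rewrite !mxE.
have [d dA] : exists d, \det A * d = 1.
  apply: nlring_unit; rewrite -det_map_mx (_ : map_mx _ _ = 1%:M) ?det1 ?oner_eq0 //.
  rewrite map_mxB map_mx1 [X in _ - X](_ : _ = 0) ?subr0 //.
  by apply/matrixP => i j; rewrite !mxE; apply/eqP; have [+ _] := CE i; apply.
move=> i; have -> : g i = d * ((\adj A *m (A *m G)) i 0).
  by rewrite mulmxA mul_adj_mx mul_scalar_mx !mxE mulrA [d * _]mulrC dA mul1r.
by apply: idealM; rewrite mxE; apply: rpred_sum => j _; exact: idealM.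
Qed.

Lemma spanning_cls I n (a : 'I_n -> R) (aI : forall i, a i \in I) :
  {subset I <= spanI a} -> spanning (fun i => cls (IdMod (aI i))).
Proof.
move=> Ia q; have /Ia/spanIP[c cE] := valP (repr q).
exists (fun i => residue R (c i)); rewrite -[q]cls_repr.
under eq_bigr do rewrite quotmI_scaleE.
rewrite -raddf_sum /=; congr (cls _); apply: val_inj; rewrite cE raddf_sum.
by apply: eq_bigr.
Qed.

Lemma mu_le_spanI I n (a : 'I_n -> R) : I =i spanI a -> (mu I <= n)%N.
Proof.
move=> Ia; have aI i : a i \in I by rewrite Ia spanI_gen.
have vspan := spanning_cls aI (fun x => etrans (esym (Ia x))).
exact: has_dim_le_spanning vspan (has_dim_dimension vspan).
Qed.

(** Representatives of a basis of $I/mI$ generate $I$: apply [nakayama] to any finite generating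
    family [g] of $I$. *)
Lemma mu_spanI I : exists a : 'I_(mu I) -> R, I =i spanI a.
Proof.
have [p [g Ig]] := (noetherianP R).1 (@nlring_noetherian k R) I.
have gI i : g i \in I by rewrite Ig spanI_gen.
have vspan := spanning_cls gI (fun x => etrans (esym (Ig x))).
have [f [h fK hK]] : has_dim (quotmI I) (mu I) := has_dim_dimension vspan.
pose u i : idmod I := repr (h (delta_mx 0 i)).
exists (fun i => val (u i)) => x; apply/idP/idP; last first.
  by apply: spanI_sub => i; exact: valP.
rewrite Ig; apply: spanI_sub; apply: nakayama => l.
pose r := f (cls (IdMod (gI l))).
have /eq_cls gr : cls (IdMod (gI l)) = cls (\sum_i residue_lift R (r 0 i) *: u i).
  rewrite raddf_sum /=; under eq_bigr do rewrite -quotmI_scaleE residue_liftK.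
  apply: (can_inj fK); rewrite -/r linear_sum /= [LHS]row_sum_delta.
  by apply: eq_bigr => i _; rewrite linearZ /= cls_repr hK.
(* The combination of the [u i] has the same class as [g l], so their difference lies in $mI =
   m(g)$. *)
exists (g l - val (\sum_i residue_lift R (r 0 i) *: u i)).
  by apply: mulI_mono gr => // y; rewrite Ig.
rewrite subKr raddf_sum; apply: rpred_sum => i _; apply: idealM.
exact: (spanI_gen (fun i => val (u i) : R)).
Qed.

Lemma mu_leP I n :
  (mu I <= n)%N <-> exists a : 'I_n -> R, I =i spanI a.
Proof.
split=> [In|[a]]; last exact: mu_le_spanI.
have [a Ia] := mu_spanI I; have [b ab] := spanI_widen a In.
by exists b => x; rewrite Ia ab.
Qed.

(** * The minima [cs] and [ms] in terms of generating families *)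

Lemma minnatP (A : set nat) : A !=set0 ->
  A (minnat A) /\ forall n, A n -> (minnat A <= n)%N.
Proof.
move=> [n An].
have exA : exists n, `[< A n >] by exists n; exact/asboolP.
case: (ex_minnP exA) => p /asboolP Ap pmin.
have pP : [set n | A n /\ forall q, A q -> (n <= q)%N] p.
  by split=> // q Aq; apply: pmin; exact/asboolP.
exact: (xgetI _ pP).
Qed.

(** The hypothesis on $m$ makes the set of values nonempty, which excludes the default 0 of
    [minnat]. *)
Lemma minnat_mu_leP (P : ideal R -> Prop) n : P m ->
  (minnat [set mu I | I in [set I | P I]] <= n)%N <->
  exists I (a : 'I_n -> R), P I /\ I =i spanI a.
Proof.
move=> Pm.
have [|[I PI IE] Imin] := @minnatP [set mu I | I in [set I | P I]].
  by exists (mu m), m.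
split=> [|[J [a [PJ /mu_le_spanI Jn]]]].
  by rewrite -IE => /mu_leP[a Ia]; exists I, a.
by apply: leq_trans Jn; apply: Imin; exists J.
Qed.

(** Only $m^2 \subseteq I^2$ is recorded; the reverse inclusion follows from $I \subseteq m$. *)
Lemma cs_leP n : (cs R <= n)%N <-> exists a : 'I_n -> R,
  (forall i, a i \in m) /\ {subset mulI m m <= mulI (spanI a) (spanI a)}.
Proof.
split=> [/minnat_mu_leP[|I [a [[Im II] Ia]]]|[a [am ma]]].
- by split.
- exists a; split=> [i|x]; first by rewrite Im // Ia spanI_gen.
  by rewrite -II; apply: mulI_mono => y; rewrite Ia.
apply/minnat_mu_leP; first by split.
exists (spanI a : ideal R), a; split=> //; split; first exact: spanI_sub.
by move=> x; apply/idP/idP => [|/ma//]; apply: mulI_mono; exact: spanI_sub.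
Qed.

Lemma ms_leP n : (ms R <= n)%N <-> exists a : 'I_n -> R,
  (forall i, a i \in m) /\ {subset mulI m m <= spanI a}.
Proof.
have mm : {subset mulI m m <= m} by apply: mulI_sub => x y _; exact: idealM.
split=> [/minnat_mu_leP[|I [a [[Im mI] Ia]]]|[a [am ma]]].
- by split.
- by exists a; split=> [i|x /mI]; [rewrite Im // Ia spanI_gen | rewrite Ia].
apply/minnat_mu_leP; first by split.
by exists (spanI a : ideal R), a; split=> //; split=> //; exact: spanI_sub.
Qed.

(** * Maximal choices of ideals and the equality $m^2 = mI$ *)

Lemma noetherian_max (Q : set (ideal R)) : Q !=set0 ->
  exists2 I, Q I & forall J, Q J -> {subset I <= J} -> {subset J <= I}.
Proof.
move=> [I0 QI0]; pose P (A : set R) := A = set0 \/ exists2 I : ideal R, A = [set` I] & Q I.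
have [F FP Ftot|A [PA Amax]] := @Zorn_bigcup R P.
  have [[X [z [FX Xz]]]|F0] := pselect (exists X z, F X /\ X z); last first.
    left; apply/seteqP; split=> // z [X FX Xz].
    by apply: F0; exists X, z.
  have Fmem Y y : F Y -> Y y -> exists2 I : ideal R, Y = [set` I] & Q I.
    by move=> /FP[-> []|].
  pose U : {pred R^o} := fun z => `[< (\bigcup_(Y in F) Y) z >].
  have F2 Y Z : F Y -> F Z -> exists2 W, F W & Y `<=` W /\ Z `<=` W.
    by move=> FY FZ; have [YZ|ZY] := Ftot _ _ FY FZ; [exists Z|exists Y] => //; split.
  have U_closed : submod_closed U.
    split=> [|c u v /asboolP[Y FY Yu] /asboolP[Z FZ Zv]]; apply/asboolP.
      by exists X => //; have [I -> _] := Fmem _ _ FX Xz; exact: rpred0.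
    have [W FW [YW ZW]] := F2 _ _ FY FZ.
    exists W => //; move: (YW _ Yu) (ZW _ Zv); have [I -> _] := Fmem _ _ FW (YW _ Yu).
    by move=> /= uI vI; rewrite rpredD ?rpredZ.
  have [n [g Ug]] := (noetherianP R).1 (@nlring_noetherian k R) (ideal_of U_closed).
  have [W FW [XW Wg]] : exists2 W, F W & X `<=` W /\ forall i, W (g i).
    have : forall i, exists2 Y, F Y & Y (g i).
      move=> i; have : g i \in ideal_of U_closed by rewrite Ug spanI_gen.
      by move=> /asboolP[Y FY Yg]; exists Y.
    (* Induction on the number of generators: of two members of the chain, the larger contains the
       generators found in both. *)
    elim: n g {Ug} => [|n IHn] g gF; first by exists X => //; split=> // -[].
    have [W FW [XW Wg]] := IHn _ (fun i => gF (lift ord0 i)).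
    have [Y FY Yg] := gF ord0; have [Z FZ [WZ YZ]] := F2 _ _ FW FY.
    exists Z => //; split=> [x /XW /WZ//|i].
    by case: (unliftP ord0 i) => [j|] ->; [exact/WZ/Wg|exact: YZ].
  suff -> : \bigcup_(Y in F) Y = W by exact: FP.
  apply/seteqP; split=> [x Ux|x Wx]; last by exists W.
  have : x \in ideal_of U_closed by exact/asboolP.
  have [I WI _] := Fmem _ _ FW (XW _ Xz); move: Wg; rewrite Ug WI => Wg.
  exact: spanI_sub.
have sub_max I : Q I -> A `<=` [set` I] -> A = [set` I].
  move=> QI AI; apply: contrapT => AneI; apply: (Amax [set` I]).
    by split=> // IA; apply: AneI; exact/seteqP.
  by right; exists I.
(* The empty set is not maximal, since [I0] lies strictly above it. *)
have [A0|[I AI QI]] := PA.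
  have AI0 : A = [set` I0] by apply: sub_max => //; rewrite A0.
  have : [set` I0] (0 : R) by exact: rpred0.
  by rewrite -AI0 A0.
exists I => // J QJ IJ.
have AJ : A = [set` J] by apply: sub_max => // x; rewrite AI; exact: IJ.
by move=> x xJ; have : A x by [rewrite AJ]; rewrite AI.
Qed.

(** In $xy = \sum_i c_i a_i$ some $c_j$ is a unit, as otherwise $xy \in m(a)$. Solving for $a_j$
    expresses it through $x$ and the other $a_i$. Moreover $x \in (a)$ would force $yx \in m(a)$. *)
Lemma spanI_exchange n (a : 'I_n -> R) (x y : R) :
    y \in m -> x * y \in spanI a -> x * y \notin mulI m (spanI a) ->
  exists j, let b i := if i == j then x else a i in
    {subset spanI a <= spanI b} /\ x \notin spanI a.
Proof.
move=> ym /spanIP[c xy] xyN.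
have [j cj] : exists j, c j \notin m.
  apply: contrapT => cm; move: xyN; rewrite xy => /negP; apply.
  apply: rpred_sum => i _; apply: mem_mulI; last exact: spanI_gen.
  by apply/negPn/negP => ci; apply: cm; exists i.
exists j => b; split; last first.
  by apply: contra xyN => xa; rewrite mulrC; exact: mem_mulI.
have [d cd] := nlring_unit cj.
have bx : x \in spanI b by have := spanI_gen b j; rewrite /b eqxx.
have ba i : i != j -> a i \in spanI b.
  by move=> /negPf ij; have := spanI_gen b i; rewrite /b ij.
apply: spanI_sub => i; have [->|/ba//] := eqVneq i j.
have -> : a j = d * (x * y - \sum_(i | i != j) c i * a i).
  by rewrite xy (bigD1 j) //= addrK mulrA [d * _]mulrC cd mul1r.
apply: idealM; apply: rpredB; first by rewrite mulrC; exact: idealM.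
by apply: rpred_sum => l lj; exact/idealM/ba.
Qed.

(** Strengthens [ms_leP] from $m^2 \subseteq I$ to $m^2 \subseteq mI$ at no cost in generators,
    because [spanI_exchange] enlarges $I$ while keeping [n] fixed. *)
Lemma ms_le_reduction n : (ms R <= n)%N -> exists a : 'I_n -> R,
  (forall i, a i \in m) /\ {subset mulI m m <= mulI m (spanI a)}.
Proof.
pose Q (I : ideal R) := exists a : 'I_n -> R,
  [/\ I = spanI a :> {pred R^o}, forall i, a i \in m & {subset mulI m m <= spanI a}].
move=> /ms_leP[a0 [a0m ma0]].
have [|I [a [Ia am ma]] Imax] := @noetherian_max Q; first by exists (spanI a0 : ideal R), a0.
exists a; split=> //; apply: mulI_sub => x y xm ym; apply/negPn/negP => xyN.
have [j [ab /negP]] := spanI_exchange ym (ma _ (mem_mulI xm ym)) xyN.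
set b : 'I_n -> R := fun i => _ in ab *; apply.
(* Maximality of [I] would put [x] into [I], which the exchange excludes. *)
suff /(_ x) : {subset spanI b <= I}.
  by rewrite Ia; apply; have := spanI_gen b j; rewrite /b eqxx.
apply: (Imax (spanI b : ideal R)); last by rewrite Ia.
by exists b; split=> // [i|z /ma /ab//]; rewrite /b; case: ifP.
Qed.

End Generators.

(** * Surjections of local rings over $k$ and their sections on the maximal ideal *)

Section Surjections.
Local Open Scope ring_scope.
Variables (k : fieldType) (R S : nlring k) (p : {rmorphism R -> S}).
Hypothesis p_surj : forall s, exists r, p r = s.
Hypothesis p_residue : forall r, residue S (p r) = residue R r.

Lemma maxideal_im r : (p r \in maxideal S) = (r \in maxideal R).
Proof. by rewrite !maxidealE p_residue. Qed.

Lemma mulI_im (I J : ideal R) (I' J' : ideal S) :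
    (forall r, r \in I -> p r \in I') -> (forall r, r \in J -> p r \in J') ->
  forall r, r \in mulI I J -> p r \in mulI I' J'.
Proof.
move=> pI pJ r /mulIP[n [a [b [aI bJ ->]]]]; rewrite rmorph_sum.
by apply: rpred_sum => i _; rewrite rmorphM mem_mulI ?pI ?pJ.
Qed.

Lemma spanI_im n (a : 'I_n -> R) r : r \in spanI a -> p r \in spanI (p \o a).
Proof.
move=> /spanIP[c ->]; rewrite rmorph_sum; apply: rpred_sum => i _.
by rewrite rmorphM; apply: idealM; exact: (spanI_gen (p \o a)).
Qed.

(** Lift the factors separately; the lifts stay in the maximal ideal because [p] preserves
    residues. *)
Lemma mul_max_lift s : s \in mulI (maxideal S) (maxideal S) ->
  exists2 r, r \in mulI (maxideal R) (maxideal R) & p r = s.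
Proof.
move=> /mulIP[n [a [b [am bm ->]]]].
have [/choice[a' aE] /choice[b' bE]] := (fun i => p_surj (a i), fun i => p_surj (b i)).
exists (\sum_i a' i * b' i).
  by apply: rpred_sum => i _; rewrite mem_mulI // -maxideal_im ?aE ?bE.
by rewrite rmorph_sum; apply: eq_bigr => i _; rewrite rmorphM aE bE.
Qed.

Lemma cs_le_im : (cs S <= cs R)%N.
Proof.
have [a [am ma]] := (cs_leP R _).1 (leqnn (cs R)).
apply/cs_leP; exists (p \o a); split=> [i|s]; first by rewrite maxideal_im.
by move=> /mul_max_lift[r /ma rR <-]; apply: mulI_im rR => x; exact: spanI_im.
Qed.

Lemma ms_le_im : (ms S <= ms R)%N.
Proof.
have [a [am ma]] := (ms_leP R _).1 (leqnn (ms R)).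
apply/ms_leP; exists (p \o a); split=> [i|s]; first by rewrite maxideal_im.
by move=> /mul_max_lift[r /ma rR <-]; exact: spanI_im.
Qed.

(* [j] is an R-linear section of [p] on the maximal ideal of S; its values
   outside of it are irrelevant. *)
Variable j : S -> R.
Hypothesis jK : forall s, s \in maxideal S -> p (j s) = s.
Hypothesis j0 : j 0 = 0.
Hypothesis j_linear : forall r s t, s \in maxideal S -> t \in maxideal S ->
  j (p r * s + t) = r * j s + j t.

(** Since $s = p(j(s))$, multiplication by $s$ is the action of $j(s)$, and linearity of [j]
    applies. *)
Lemma j_mul s t : s \in maxideal S -> t \in maxideal S -> j (s * t) = j s * j t.
Proof.
move=> sm tm; rewrite -{1}(jK sm) -[_ * t]addr0 j_linear ?rpred0 //.
by rewrite j0 addr0.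
Qed.

(** Knowing that the preimage of [K] is an ideal of [S] allows inclusions into it to be checked on
    generators. Membership in the maximal ideal is built in because [j] is controlled only there. *)
Lemma j_preim_submod_closed (K : ideal R) :
  submod_closed ((fun s => (s \in maxideal S) && (j s \in K)) : {pred S^o}).
Proof.
split=> [|c s t /andP[sm sK] /andP[tm tK]]; apply/andP.
  by rewrite j0; split; exact: rpred0.
split; first by rewrite rpredD ?rpredZ.
have [r <-] := p_surj c; rewrite [_ *: _]/(_ * _) j_linear //.
by apply: rpredD => //; exact: idealM.
Qed.

Definition j_preim (K : ideal R) : ideal S := ideal_of (j_preim_submod_closed K).

Lemma j_preimP (K : ideal R) (s : S) :
  reflect (s \in maxideal S /\ j s \in K) (s \in j_preim K).
Proof. exact: andP. Qed.

End Surjections.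

(** * The two projections of the fiber product and the bounds on its invariants *)

Section Fiber_product_invariants.
Local Open Scope ring_scope.
Variables (k : fieldType) (S T : nlring k).
Local Notation R := (fiber_product S T).

Definition fst_fiber (x : R) : S := (fiberval x).1.
Definition snd_fiber (x : R) : T := (fiberval x).2.

HB.instance Definition _ :=
  GRing.RMorphism.copy fst_fiber (fst \o (val : fiber S T -> S * T)).
HB.instance Definition _ :=
  GRing.RMorphism.copy snd_fiber (snd \o (val : fiber S T -> S * T)).

Lemma fst_fiber_surj s : exists x, fst_fiber x = s.
Proof. exact: fiber_fst. Qed.

Lemma snd_fiber_surj t : exists x, snd_fiber x = t.
Proof. exact: fiber_snd. Qed.

Lemma residue_fst (x : R) : residue S (fst_fiber x) = residue R x.
Proof. by []. Qed.

(** The residue of the fiber product is computed in [S]; the fiber condition carries it over to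
    [T]. *)
Lemma residue_snd (x : R) : residue T (snd_fiber x) = residue R x.
Proof. by rewrite -(eqP (valP (x : fiber S T) : residue S _ == _)). Qed.

Lemma fiber_eq (x y : R) :
  fst_fiber x = fst_fiber y -> snd_fiber x = snd_fiber y -> x = y.
Proof.
move=> xy1 xy2; apply: (@val_inj _ _ (fiber S T)).
by rewrite /= [LHS]surjective_pairing [RHS]surjective_pairing; congr (_, _).
Qed.

(* [(s, 0)] and [(0, t)]; junk outside of the maximal ideals. *)
Definition inl_fiber (s : S) : R := insubd (0 : fiber S T) (s, 0).
Definition inr_fiber (t : T) : R := insubd (0 : fiber S T) (0, t).

Lemma inl_fiberK s : s \in maxideal S ->
  fst_fiber (inl_fiber s) = s /\ snd_fiber (inl_fiber s) = 0.
Proof.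
rewrite maxidealE => /eqP s0; rewrite /fst_fiber /snd_fiber.
have -> : fiberval (inl_fiber s) = (s, 0); last by [].
by apply: (@insubdK _ _ (fiber S T)); rewrite fiber_predE /= s0 rmorph0.
Qed.

Lemma inr_fiberK t : t \in maxideal T ->
  fst_fiber (inr_fiber t) = 0 /\ snd_fiber (inr_fiber t) = t.
Proof.
rewrite maxidealE => /eqP t0; rewrite /fst_fiber /snd_fiber.
have -> : fiberval (inr_fiber t) = (0, t); last by [].
by apply: (@insubdK _ _ (fiber S T)); rewrite fiber_predE /= t0 rmorph0.
Qed.

Lemma inl_fiber0 : inl_fiber 0 = 0.
Proof.
have [E1 E2] := inl_fiberK (rpred0 (maxideal S)).
by apply: fiber_eq; rewrite ?E1 ?E2 rmorph0.
Qed.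

Lemma inr_fiber0 : inr_fiber 0 = 0.
Proof.
have [E1 E2] := inr_fiberK (rpred0 (maxideal T)).
by apply: fiber_eq; rewrite ?E1 ?E2 rmorph0.
Qed.

Lemma inl_fiber_linear r s t : s \in maxideal S -> t \in maxideal S ->
  inl_fiber (fst_fiber r * s + t) = r * inl_fiber s + inl_fiber t.
Proof.
move=> sm tm; have [E1 E2] := inl_fiberK (rpredD (idealM (fst_fiber r) sm) tm).
have [[s1 s2] [t1 t2]] := (inl_fiberK sm, inl_fiberK tm).
apply: fiber_eq; first by rewrite E1 rmorphD rmorphM /= s1 t1.
by rewrite E2 rmorphD rmorphM /= s2 t2 mulr0 addr0.
Qed.

Lemma inr_fiber_linear r s t : s \in maxideal T -> t \in maxideal T ->
  inr_fiber (snd_fiber r * s + t) = r * inr_fiber s + inr_fiber t.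
Proof.
move=> sm tm; have [E1 E2] := inr_fiberK (rpredD (idealM (snd_fiber r) sm) tm).
have [[s1 s2] [t1 t2]] := (inr_fiberK sm, inr_fiberK tm).
apply: fiber_eq; last by rewrite E2 rmorphD rmorphM /= s2 t2.
by rewrite E1 rmorphD rmorphM /= s1 t1 mulr0 addr0.
Qed.

(** Both coordinates have residue 0, so $(x_1, 0)$ and $(0, x_2)$ belong to the fiber product. *)
Lemma fiber_decomp x : x \in maxideal R ->
  x = inl_fiber (fst_fiber x) + inr_fiber (snd_fiber x).
Proof.
move=> xm.
have [|s1 s2] := @inl_fiberK (fst_fiber x).
  by rewrite maxidealE residue_fst.
have [|t1 t2] := @inr_fiberK (snd_fiber x).
  by rewrite maxidealE residue_snd.
by apply: fiber_eq; rewrite rmorphD /= ?s1 ?s2 ?t1 ?t2 ?addr0 ?add0r.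
Qed.

Lemma inl_inr_fiber s t : s \in maxideal S -> t \in maxideal T ->
  inl_fiber s * inr_fiber t = 0.
Proof.
move=> /inl_fiberK[s1 s2] /inr_fiberK[t1 t2].
by apply: fiber_eq; rewrite rmorphM rmorph0 /= ?t1 ?s2 ?mulr0 ?mul0r.
Qed.

Definition inl_preim := j_preim fst_fiber_surj inl_fiber0 inl_fiber_linear.
Definition inr_preim := j_preim snd_fiber_surj inr_fiber0 inr_fiber_linear.

(** A product $xy$ splits as $(x_1 y_1, 0) + (0, x_2 y_2)$, so $m_R^2 = m_S^2 \oplus m_T^2$ and each
    summand can be tested in its own ring. *)
Lemma mul_max_fiber_sub (K : ideal R) :
    {subset mulI (maxideal S) (maxideal S) <= inl_preim K} ->
    {subset mulI (maxideal T) (maxideal T) <= inr_preim K} ->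
  {subset mulI (maxideal R) (maxideal R) <= K}.
Proof.
move=> SK TK; apply: mulI_sub => x y xm ym.
rewrite (fiber_decomp (idealM x ym)) !rmorphM; apply: rpredD.
  suff /SK/j_preimP[] : fst_fiber x * fst_fiber y \in mulI (maxideal S) (maxideal S).
    by [].
  by apply: mem_mulI; rewrite maxidealE residue_fst.
suff /TK/j_preimP[] : snd_fiber x * snd_fiber y \in mulI (maxideal T) (maxideal T).
  by [].
by apply: mem_mulI; rewrite maxidealE residue_snd.
Qed.

Lemma maxideal_inl s : s \in maxideal S -> inl_fiber s \in maxideal R.
Proof. by move=> sm; rewrite maxidealE -residue_fst (inl_fiberK sm).1. Qed.

Lemma maxideal_inr t : t \in maxideal T -> inr_fiber t \in maxideal R.
Proof. by move=> tm; rewrite maxidealE -residue_snd (inr_fiberK tm).2. Qed.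

Lemma inl_fiberM s t : s \in maxideal S -> t \in maxideal S ->
  inl_fiber (s * t) = inl_fiber s * inl_fiber t.
Proof.
apply: (j_mul (p := fst_fiber)); last exact: inl_fiber_linear.
  by move=> u /inl_fiberK[].
exact: inl_fiber0.
Qed.

Lemma inr_fiberM s t : s \in maxideal T -> t \in maxideal T ->
  inr_fiber (s * t) = inr_fiber s * inr_fiber t.
Proof.
apply: (j_mul (p := snd_fiber)); last exact: inr_fiber_linear.
  by move=> u /inr_fiberK[].
exact: inr_fiber0.
Qed.

Lemma cs_fiber_product_le : (cs R <= cs S + cs T)%N.
Proof.
have [a [am ma]] := (cs_leP S _).1 (leqnn (cs S)).
have [b [bm mb]] := (cs_leP T _).1 (leqnn (cs T)).
pose g (i : 'I_(cs S + cs T)) : R :=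
  match split i with inl i => inl_fiber (a i) | inr i => inr_fiber (b i) end.
apply/cs_leP; exists g; split=> [i|].
  by rewrite /g; case: (split i) => j; [exact: maxideal_inl|exact: maxideal_inr].
have aK : {subset spanI a <= inl_preim (spanI g : ideal R)}.
  apply: spanI_sub => i; apply/j_preimP; split=> //.
  by have := spanI_gen g (lshift _ i); rewrite /g (unsplitK (inl i)).
have bK : {subset spanI b <= inr_preim (spanI g : ideal R)}.
  apply: spanI_sub => i; apply/j_preimP; split=> //.
  by have := spanI_gen g (rshift _ i); rewrite /g (unsplitK (inr i)).
(* It is enough to treat products $uv$ with both factors in $I_S$, or both in $I_T$; their
   embeddings lie in the ideal generated by [g], so the embedded product lies in its square. *)
apply: mul_max_fiber_sub => [s /ma|s /mb]; move: s; apply: mulI_sub.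
  move=> u v /aK/j_preimP[um uK] /aK/j_preimP[vm vK]; apply/j_preimP.
  by rewrite inl_fiberM // mem_mulI ?idealM.
move=> u v /bK/j_preimP[um uK] /bK/j_preimP[vm vK]; apply/j_preimP.
by rewrite inr_fiberM // mem_mulI ?idealM.
Qed.

(* The generators [(a i, b i)] recover [(s a i, 0)] for [s] in [m_S] as
   [(s, 0) (a i, b i)]; this is why [m_S^2] has to lie in [m_S (a i)]. *)
Lemma ms_fiber_product_le : (ms R <= maxn (ms S) (ms T))%N.
Proof.
(* Both families get the common length [maxn (ms S) (ms T)], so that they can be paired index by
   index. *)
have [a [am ma]] := ms_le_reduction (leq_maxl (ms S) (ms T)).
have [b [bm mb]] := ms_le_reduction (leq_maxr (ms S) (ms T)).
pose g i : R := inl_fiber (a i) + inr_fiber (b i).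
apply/ms_leP; exists g; split=> [i|].
  by apply: rpredD; [exact: maxideal_inl|exact: maxideal_inr].
apply: mul_max_fiber_sub => [s /ma|s /mb]; move: s; apply: mulI_sub.
  move=> u v um /spanIP[c ->]; rewrite mulr_sumr; apply: rpred_sum => i _.
  rewrite mulrA; apply/j_preimP; have ucm : u * c i \in maxideal S.
    by rewrite mulrC idealM.
  split; first exact: idealM.
  (* The added 0 is the cross product $(u c_i, 0)(0, b_i)$; factoring then exhibits a multiple of
     [g i]. *)
  rewrite inl_fiberM // -[_ * _]addr0 -(inl_inr_fiber ucm (bm i)) -mulrDr.
  by apply: idealM; exact: (spanI_gen g).
move=> u v um /spanIP[c ->]; rewrite mulr_sumr; apply: rpred_sum => i _.
rewrite mulrA; apply/j_preimP; have ucm : u * c i \in maxideal T.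
  by rewrite mulrC idealM.
split; first exact: idealM.
rewrite inr_fiberM // -[_ * _]add0r -(inl_inr_fiber (am i) ucm).
rewrite [inl_fiber _ * _]mulrC -mulrDr.
by apply: idealM; exact: (spanI_gen g).
Qed.

End Fiber_product_invariants.

Theorem proposition3p14 (k : fieldType) (S T : nlring k) :
  [/\ maxn (cs S) (cs T) <= cs (fiber_product S T),
      cs (fiber_product S T) <= cs S + cs T &
      ms (fiber_product S T) = maxn (ms S) (ms T)].
Proof.
split; first 1 last; first exact: cs_fiber_product_le.
  apply/eqP; rewrite eqn_leq ms_fiber_product_le geq_max.
  rewrite (ms_le_im (@fst_fiber_surj _ S T) (@residue_fst _ S T)).
  exact: ms_le_im (@snd_fiber_surj _ S T) (@residue_snd _ S T).
rewrite geq_max (cs_le_im (@fst_fiber_surj _ S T) (@residue_fst _ S T)).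
exact: cs_le_im (@snd_fiber_surj _ S T) (@residue_snd _ S T).
Qed.
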